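(* Let $\Lambda$ be a row-finite locally convex $k$-graph and $R$ a unital commutative ring. Then $\mathrm{KP}_R(\Lambda)$ is a prime ring if and only if $R$ is an integral domain and $\Lambda^0$ satisfies Condition (MT3), i.e. for all $v_1,v_2\in\Lambda^0$ there is $w\in\Lambda^0$ with $v_1\Lambda w\neq\emptyset$ and $v_2\Lambda w\neq\emptyset$.
   Context: A $k$-graph is a countable category $\Lambda$ (vertices $\Lambda^0$; range, source $r,s$) with functor $d:\Lambda\to\mathbb{N}^k$ with unique factorization ($d(\lambda)=m+n$ gives unique $\lambda=\mu\nu$ with $d(\mu)=m$, $d(\nu)=n$). $v\Lambda w=\{\lambda:r(\lambda)=v,s(\lambda)=w\}$, $v\Lambda^n=\{\lambda:r(\lambda)=v,d(\lambda)=n\}$; row-finite: each $v\Lambda^n$ finite. Locally convex: for $v\in\Lambda^0$, $i\ne j$, $\lambda\in v\Lambda^{e_i}$, $\mu\in v\Lambda^{e_j}$, the sets $s(\lambda)\Lambda^{e_j}$, $s(\mu)\Lambda^{e_i}$ are nonempty. $\Lambda^{\le n}=\{\lambda: d(\lambda)\le n,\ s(\lambda)\Lambda^{e_i}=\emptyset \text{ whenever } d(\lambda)+e_i\le n\}$. $\mathrm{KP}_R(\Lambda)$ is the universal $R$-algebra generated by $p_v$ ($v\in\Lambda^0$), $s_\lambda,s_{\lambda^*}$ ($d(\lambda)\ne0$) subject to: the $p_v$ are mutually orthogonal idempotents; $s_\lambda s_\mu=s_{\lambda\mu}$, $s_{\mu^*}s_{\lambda^*}=s_{(\lambda\mu)^*}$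 when $s(\lambda)=r(\mu)$, $p_{r(\lambda)}s_\lambda=s_\lambda p_{s(\lambda)}=s_\lambda$, $p_{s(\lambda)}s_{\lambda^*}=s_{\lambda^*}p_{r(\lambda)}=s_{\lambda^*}$; $s_{\lambda^*}s_\mu=\delta_{\lambda,\mu}p_{s(\lambda)}$ for $\lambda,\mu\in\Lambda^{\le n}$, $n\in\mathbb{N}^k\setminus\{0\}$; $p_v=\sum_{\lambda\in v\Lambda^{\le n}}s_\lambda s_{\lambda^*}$ for $n\in\mathbb{N}^k\setminus\{0\}$ (convention $s_v=s_{v^*}=p_v$). A ring is prime if its zero ideal is prime. *)

(* Defs.v *)
From HB Require Import structures.
From mathcomp Require Import all_boot all_algebra.
Set Implicit Arguments. Unset Strict Implicit. Unset Printing Implicit Defensive.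
Import GRing.Theory.
Local Open Scope ring_scope.

Definition deg (k : nat) := {ffun 'I_k -> nat}.
Definition dzero (k : nat) : deg k := [ffun => 0%N].
Definition dadd (k : nat) (m n : deg k) : deg k := [ffun i => (m i + n i)%N].
Definition dle (k : nat) (m n : deg k) : bool := [forall i, (m i <= n i)%N].
Definition dunit (k : nat) (i : 'I_k) : deg k := [ffun j => nat_of_bool (j == i)].

(* ---------- k-graphs ----------
   A k-graph is a countable category (objects kV, morphisms kP, range kr,
   source ks, identities kid, composition kcomp, meaningful when
   ks lam = kr mu) with a degree functor kd into N^k satisfying the
   unique factorisation property. *)
Record kgraph (k : nat) := KGraph {
  kV : countType;
  kP : countType;
  kr : kP -> kV;
  ks : kP -> kV;
  kid : kV -> kP;
  kcomp : kP -> kP -> kP;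
  kd : kP -> deg k;
  kr_id : forall v, kr (kid v) = v;
  ks_id : forall v, ks (kid v) = v;
  kr_comp : forall l m, ks l = kr m -> kr (kcomp l m) = kr l;
  ks_comp : forall l m, ks l = kr m -> ks (kcomp l m) = ks m;
  kid_l : forall l, kcomp (kid (kr l)) l = l;
  kid_r : forall l, kcomp l (kid (ks l)) = l;
  kcompA : forall l m n, ks l = kr m -> ks m = kr n ->
     kcomp l (kcomp m n) = kcomp (kcomp l m) n;
  kd_id : forall v, kd (kid v) = dzero k;
  kd_comp : forall l m, ks l = kr m -> kd (kcomp l m) = dadd (kd l) (kd m);
  kfactor : forall l (m n : deg k), kd l = dadd m n ->
     exists mu, exists nu,
       [/\ ks mu = kr nu, kd mu = m, kd nu = n, kcomp mu nu = l &
        forall mu' nu', ks mu' = kr nu' -> kd mu' = m -> kd nu' = n ->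
          kcomp mu' nu' = l -> mu' = mu /\ nu' = nu]
}.

Section KG.
Variables (k : nat) (L : kgraph k).

Definition row_finite : Prop :=
  forall (v : kV L) (n : deg k), exists s : seq (kP L),
    forall l, kr l = v -> kd l = n -> l \in s.

Definition locally_convex : Prop :=
  forall (v : kV L) (i j : 'I_k), i != j ->
  forall l m : kP L, kr l = v -> kd l = dunit i -> kr m = v -> kd m = dunit j ->
    (exists a : kP L, kr a = ks l /\ kd a = dunit j) /\
    (exists b : kP L, kr b = ks m /\ kd b = dunit i).

Definition in_le (n : deg k) (l : kP L) : Prop :=
  dle (kd l) n /\
  forall i : 'I_k, dle (dadd (kd l) (dunit i)) n ->
    ~ exists a : kP L, kr a = ks l /\ kd a = dunit i.

Definition MT3 : Prop :=
  forall v1 v2 : kV L, exists w : kV L,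
    (exists l : kP L, kr l = v1 /\ ks l = w) /\
    (exists m : kP L, kr m = v2 /\ ks m = w).

(* ---------- the Kumjian-Pask algebra KP_R(L) ----------
   Realised as the set of formal (non-unital, associative) R-algebra
   expressions in the generators p_v, s_lam, s_lam^*, modulo the smallest
   congruence containing the R-algebra axioms and the KP relations. *)
Variable R : comPzRingType.

Inductive kpterm : Type :=
| tzero : kpterm
| tadd : kpterm -> kpterm -> kpterm
| tneg : kpterm -> kpterm
| tscale : R -> kpterm -> kpterm
| tmul : kpterm -> kpterm -> kpterm
| tp : kV L -> kpterm
| ts : kP L -> kpterm
| tsstar : kP L -> kpterm.

Definition tsum (s : seq kpterm) : kpterm := foldr tadd tzero s.

Inductive kp_eq : kpterm -> kpterm -> Prop :=
| kp_refl a : kp_eq a a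
| kp_sym a b : kp_eq a b -> kp_eq b a
| kp_trans a b c : kp_eq a b -> kp_eq b c -> kp_eq a c
| kp_cadd a a' b b' : kp_eq a a' -> kp_eq b b' -> kp_eq (tadd a b) (tadd a' b')
| kp_cneg a a' : kp_eq a a' -> kp_eq (tneg a) (tneg a')
| kp_cscale r a a' : kp_eq a a' -> kp_eq (tscale r a) (tscale r a')
| kp_cmul a a' b b' : kp_eq a a' -> kp_eq b b' -> kp_eq (tmul a b) (tmul a' b')
| kp_addA a b c : kp_eq (tadd a (tadd b c)) (tadd (tadd a b) c)
| kp_addC a b : kp_eq (tadd a b) (tadd b a)
| kp_add0 a : kp_eq (tadd tzero a) a
| kp_addN a : kp_eq (tadd (tneg a) a) tzero
| kp_mulA a b c : kp_eq (tmul a (tmul b c)) (tmul (tmul a b) c)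
| kp_mulDl a b c : kp_eq (tmul (tadd a b) c) (tadd (tmul a c) (tmul b c))
| kp_mulDr a b c : kp_eq (tmul a (tadd b c)) (tadd (tmul a b) (tmul a c))
| kp_scaleDr r a b : kp_eq (tscale r (tadd a b)) (tadd (tscale r a) (tscale r b))
| kp_scaleDl r r' a : kp_eq (tscale (r + r') a) (tadd (tscale r a) (tscale r' a))
| kp_scaleA r r' a : kp_eq (tscale (r * r') a) (tscale r (tscale r' a))
| kp_scale1 a : kp_eq (tscale 1 a) a
| kp_scaleMl r a b : kp_eq (tscale r (tmul a b)) (tmul (tscale r a) b)
| kp_scaleMr r a b : kp_eq (tscale r (tmul a b)) (tmul a (tscale r b))
(* convention s_v = s_{v^*} = p_v for degree-zero paths *)
| kp_deg0 l : kd l = dzero k -> kp_eq (ts l) (tp (kr l))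
| kp_deg0s l : kd l = dzero k -> kp_eq (tsstar l) (tp (kr l))
| kp_pidem v : kp_eq (tmul (tp v) (tp v)) (tp v)
| kp_porth v w : v <> w -> kp_eq (tmul (tp v) (tp w)) tzero
| kp_smul l m : kd l != dzero k -> kd m != dzero k -> ks l = kr m ->
    kp_eq (tmul (ts l) (ts m)) (ts (kcomp l m))
| kp_ssmul l m : kd l != dzero k -> kd m != dzero k -> ks l = kr m ->
    kp_eq (tmul (tsstar m) (tsstar l)) (tsstar (kcomp l m))
| kp_ps l : kd l != dzero k -> kp_eq (tmul (tp (kr l)) (ts l)) (ts l)
| kp_sp l : kd l != dzero k -> kp_eq (tmul (ts l) (tp (ks l))) (ts l)
| kp_pss l : kd l != dzero k -> kp_eq (tmul (tp (ks l)) (tsstar l)) (tsstar l)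
| kp_ssp l : kd l != dzero k -> kp_eq (tmul (tsstar l) (tp (kr l))) (tsstar l)
| kp_ck_eq n l : n != dzero k -> in_le n l ->
    kp_eq (tmul (tsstar l) (ts l)) (tp (ks l))
| kp_ck_neq n l m : n != dzero k -> in_le n l -> in_le n m -> l <> m ->
    kp_eq (tmul (tsstar l) (ts m)) tzero
(* (KP4): p_v = sum_{lam in v Lambda^{<= n}} s_lam s_lam^* ; stated for any
   duplicate-free enumeration of the (finite, by row-finiteness) set *)
| kp_ck_sum n v (s : seq (kP L)) : n != dzero k -> uniq s ->
    (forall l, l \in s <-> kr l = v /\ in_le n l) ->
    kp_eq (tp v) (tsum (map (fun l => tmul (ts l) (tsstar l)) s)).

(* two-sided ring ideals of KP_R(L) (as kp_eq-saturated sets of terms) *)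
Definition kp_ideal (I : kpterm -> Prop) : Prop :=
  [/\ I tzero,
      (forall a b, I a -> I b -> I (tadd a b)),
      (forall a, I a -> I (tneg a)),
      (forall a x, I a -> I (tmul x a) /\ I (tmul a x)) &
      (forall a b, kp_eq a b -> I a -> I b)].

Definition KP_prime : Prop :=
  (exists a, ~ kp_eq a tzero) /\
  forall I J : kpterm -> Prop, kp_ideal I -> kp_ideal J ->
    (forall a b, I a -> J b -> kp_eq (tmul a b) tzero) ->
    (forall a, I a -> kp_eq a tzero) \/ (forall b, J b -> kp_eq b tzero).

End KG.

Definition is_integral_domain (R : comPzRingType) : Prop :=
  (1 : R) != 0 /\ forall a b : R, a * b = 0 -> a = 0 \/ b = 0.

(* Main.v *)
Require Import Defs.
From mathcomp Require Import all_boot all_algebra.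
From HB Require Import structures.
From mathcomp Require Import all_order generic_quotient boolp zify.
Set Implicit Arguments. Unset Strict Implicit. Unset Printing Implicit Defensive.
Import Order.TTheory GRing.Theory Num.Theory.

(** Order [Z^k] lexicographically.  Multiplying a nonzero [a] on the right by
    [s_m] for a suitable, sufficiently long path [m] gives a nonzero combination
    of distinct real paths [s_l]; multiplying on the left by [s_{l0}^*] for a
    path [l0] of top degree turns this into [r p_v] plus terms of negative
    degree, with [r <> 0].  Two nonzero ideals thus contain elements with
    leading terms [r p_v] and [t p_w]; compressing along paths from [v] and [w]
    to a common vertex [u], given by (MT3), their product has leading term
    [r t p_u].  The degree-twisted boundary path representation shows that this
    is nonzero when [r t <> 0].  Working with leading terms replaces both the
    grading of the algebra and the graded uniqueness theorem. *)

(** * Paths and degrees *)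

Section Degrees.
Variable k : nat.
Implicit Types m n p : deg k.

Lemma dleP m n : reflect (forall i, (m i <= n i)%N) (dle m n).
Proof. exact: forallP. Qed.

Lemma dle_refl n : dle n n.
Proof. by apply/dleP. Qed.

Lemma daddE m n i : dadd m n i = (m i + n i)%N.
Proof. by rewrite ffunE. Qed.

Lemma dzeroE i : dzero k i = 0%N.
Proof. by rewrite ffunE. Qed.

Lemma dunitE (i j : 'I_k) : dunit i j = (j == i) :> nat.
Proof. by rewrite ffunE. Qed.

Definition degE := (daddE, dzeroE, dunitE).

Lemma dadd0r n : dadd n (dzero k) = n.
Proof. by apply/ffunP => i; rewrite !degE addn0. Qed.

Lemma dadd0l n : dadd (dzero k) n = n.
Proof. by apply/ffunP => i; rewrite !degE. Qed.

Lemma dadd_inj m : injective (dadd m).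
Proof.
by move=> n p /ffunP e; apply/ffunP => i; move: (e i); rewrite !degE => /addnI.
Qed.

Lemma dle_addP m n : dle m n -> exists p, n = dadd m p.
Proof.
move=> /dleP h; exists [ffun i => (n i - m i)%N].
by apply/ffunP => i; rewrite degE ffunE subnKC.
Qed.

Lemma dle_addr m n : dle m (dadd m n).
Proof. by apply/dleP => i; rewrite degE leq_addr. Qed.

Lemma dle_unit m n i : dle m n -> dle (dadd m (dunit i)) n = (m i < n i)%N.
Proof.
move=> /dleP h; apply/dleP/idP => [/(_ i)|h' j]; rewrite !degE ?eqxx ?addn1 //.
by case: eqP => [->|_]; rewrite ?addn1 ?addn0.
Qed.

Definition dmin m n : deg k := [ffun i => minn (m i) (n i)].

End Degrees.

Section Paths.
Variables (k : nat) (L : kgraph k).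
Implicit Types (l m t u a b c : kP L) (v w : kV L) (n p q : deg k) (i j : 'I_k).

(** Cancellation in [deg k] gives [a] and [a'] equal degrees, so both factorisations are the unique
    one of that bidegree. *)
Lemma kfact_inj l l' a a' : ks l = kr a -> ks l' = kr a' -> kd l = kd l' ->
  kcomp l a = kcomp l' a' -> l = l' /\ a = a'.
Proof.
move=> sa sa' dl e.
have da : kd a = kd a'.
  by apply: (@dadd_inj _ (kd l)); rewrite -kd_comp // e kd_comp // dl.
have [mu [nu [_ _ _ _ uq]]] := kfactor (kd_comp sa).
have [-> ->] := uq l a sa erefl erefl erefl.
by have [-> ->] := uq l' a' sa' (esym dl) (esym da) (esym e).
Qed.

Lemma kcomp_inj l a a' : ks l = kr a -> ks l = kr a' ->
  kcomp l a = kcomp l a' -> a = a'.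
Proof. by move=> s1 s2 /kfact_inj[]. Qed.

Lemma kd0_id l : kd l = dzero k -> l = kid (kr l).
Proof.
move=> d0.
have h1 : kcomp (kid (kr l)) l = kcomp l (kid (ks l)) by rewrite kid_l kid_r.
by have [] := kfact_inj _ _ _ h1; rewrite ?kr_id ?ks_id ?kd_id.
Qed.

Lemma kd0_ks l : kd l = dzero k -> ks l = kr l.
Proof. by move=> /kd0_id ->; rewrite ks_id kr_id. Qed.

Definition has_edge v i := exists a, kr a = v /\ kd a = dunit i.

(* Unlike membership in [Lambda^{<= n}], this is monotone in [n] and stable
   under composition on the left. *)
Definition long n l := forall i, has_edge (ks l) i -> (n i <= kd l i)%N.

Lemma has_edge_deg c i : (0 < kd c i)%N -> has_edge (kr c) i.
Proof.
move=> h; have [p e] : exists p, kd c = dadd (dunit i) p.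
  apply: dle_addP; apply/dleP => j; rewrite degE; case: eqP => [->|//].
  by [].
have [mu [nu [s1 d1 d2 <- _]]] := kfactor e.
by exists mu; rewrite kr_comp.
Qed.

(** Below [n], the condition that [kd l + e_i] still lies below [n] just says that coordinate [i] is
    not yet full. *)
Lemma in_leP n l : in_le n l <-> dle (kd l) n /\ long n l.
Proof.
split=> -[h1 h2]; split=> // i.
  by move=> he; rewrite leqNgt; apply/negP; rewrite -(dle_unit _ h1) => /h2.
by rewrite dle_unit // ltnNge => /negP h /h2.
Qed.

Lemma in_le_kd l : in_le (kd l) l.
Proof. by apply/in_leP; split; [exact: dle_refl|move=> i]. Qed.

Lemma in_le0_id l : in_le (dzero k) l -> l = kid (kr l).
Proof.
move=> [/dleP h _]; apply: kd0_id; apply/ffunP => i.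
by have := h i; rewrite degE; case: (kd l i).
Qed.

Lemma long_comp n l m : ks l = kr m -> long n m -> long n (kcomp l m).
Proof.
move=> s1 h i; rewrite ks_comp // => /h; rewrite kd_comp // degE.
by move=> /leq_trans; apply; rewrite leq_addl.
Qed.

Lemma long_drop n l m : ks l = kr m -> long (dadd (kd l) n) (kcomp l m) ->
  long n m.
Proof.
move=> s1 h i he; have := h i; rewrite ks_comp // kd_comp // !degE leq_add2l.
exact.
Qed.

Lemma long_le n p m : dle n p -> long p m -> long n m.
Proof. by move=> /dleP h1 h2 i /h2; apply: leq_trans. Qed.

(** Cut [u] at degree [kd l]; uniqueness of factorisation identifies the first piece with [l]. *)
Lemma common_prefix l u a b : ks l = kr a -> ks u = kr b ->
  kcomp l a = kcomp u b -> dle (kd l) (kd u) ->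
  exists2 c, ks l = kr c & kcomp l c = u.
Proof.
move=> sa sb e /dle_addP[p dp].
have [l' [c [s1 d1 d2 eu _]]] := kfactor dp.
have sc : ks c = kr b by rewrite -sb -eu ks_comp.
have s1' : ks l' = kr (kcomp c b) by rewrite kr_comp.
have e' : kcomp l a = kcomp l' (kcomp c b) by rewrite kcompA // eu.
by have [ll _] := kfact_inj sa s1' (esym d1) e'; subst l'; exists c.
Qed.

(** If [l] exceeded [u] in a coordinate [i], then [b] would supply an edge of colour [i] at the
    source of [u], and [u] would already have degree at least [n i] there. *)
Lemma long_prefix n l u a b : ks l = kr a -> ks u = kr b ->
  kcomp l a = kcomp u b -> dle (kd l) n -> long n u ->
  exists2 c, ks l = kr c & kcomp l c = u.
Proof.
move=> sa sb e /dleP ln lu; apply: (common_prefix sa sb e).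
apply/dleP => i; rewrite leqNgt; apply/negP => lt.
have : (0 < kd b i)%N.
  by move: (congr1 (fun x => kd x i) e); rewrite !kd_comp // !degE; lia.
by move=> /has_edge_deg; rewrite -sb => /lu; have := ln i; lia.
Qed.

(** Each path is a prefix of the other. Hence distinct elements of [Lambda^{<= n}] have no common
    extension, which underlies their orthogonality. *)
Lemma in_le_eq n l m a b : ks l = kr a -> ks m = kr b ->
  kcomp l a = kcomp m b -> in_le n l -> in_le n m -> l = m.
Proof.
move=> sa sb e /in_leP[l1 l2] /in_leP[m1 m2].
have [c sc ec] := long_prefix sa sb e l1 m2.
have [c' sc' ec'] := long_prefix sb sa (esym e) m1 l2.
have dd : kd l = kd m.
  apply/ffunP => i; move: (congr1 (fun x => kd x i) ec).
  move: (congr1 (fun x => kd x i) ec') => /=; rewrite !kd_comp // !degE. lia.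
by have [] := kfact_inj sa sb dd e.
Qed.

(** Induction on the total degree still missing: as long as the path is not in [Lambda^{<= n}], some
    edge can be appended within the bound. *)
Lemma le_extend n l : dle (kd l) n ->
  exists2 t, ks l = kr t & in_le n (kcomp l t).
Proof.
have [N] := ubnP (\sum_i (n i - kd l i)); elim: N l => // N IH l lN ln.
have [h|] := pselect (in_le n l); first
  by exists (kid (ks l)); rewrite ?kr_id ?kid_r.
move=> h; have [i [h1 [a [ra da]]]] :
    exists i, (kd l i < n i)%N /\ has_edge (ks l) i.
  apply: contrapT => h'; apply: h; apply/in_leP; split=> // i he.
  by rewrite leqNgt; apply/negP => lt; apply: h'; exists i.
have dla : dle (kd (kcomp l a)) n by rewrite kd_comp // da dle_unit.
have [t st ht] : exists2 t, ks (kcomp l a) = kr t & in_le n (kcomp (kcomp l a) t).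
  apply: IH dla; move: lN.
  rewrite (bigD1 i) //= [in X in _ -> X](bigD1 i) //=.
  have -> : (\sum_(j < k | j != i) (n j - kd (kcomp l a) j)
    = \sum_(j < k | j != i) (n j - kd l j))%N.
    by apply: eq_bigr => j /negbTE ji; rewrite kd_comp // da !degE ji addn0.
  rewrite kd_comp // da !degE eqxx /=; move: h1.
  by move: (n i) (kd l i) (\sum_(j < k | j != i) (n j - kd l j))%N => x y S; lia.
move: st; rewrite ks_comp // => st.
by exists (kcomp a t); rewrite ?kr_comp // kcompA.
Qed.

Lemma in_le_nonempty v n : exists2 l, kr l = v & in_le n l.
Proof.
have [|t st ht] := @le_extend n (kid v).
  by rewrite kd_id; apply/dleP => i; rewrite degE.
rewrite ks_id in st.
by exists (kcomp (kid v) t) => //; rewrite kr_comp ?kr_id ?ks_id.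
Qed.

(** * Consequences of local convexity *)

Section LocallyConvex.
Hypothesis lc : locally_convex L.

(** Local convexity carries the edge of colour [i] across the first edge of [b], whose colour is
    different; induct on the length of [b]. *)
Lemma has_edge_fwd b i : kd b i = 0%N -> has_edge (kr b) i -> has_edge (ks b) i.
Proof.
have [N] := ubnP (\sum_i (kd b i)); elim: N b => // N IH b bN bi he.
have [/eqP d0|] := boolP (kd b == dzero k); first by rewrite kd0_ks.
move=> nz; have [j hj] : exists j, (0 < kd b j)%N.
  apply/existsP; apply: contraNT nz => /existsPn h; apply/eqP/ffunP => j.
  by have := h j; rewrite degE -leqNgt leqn0 => /eqP.
have [p e] : exists p, kd b = dadd (dunit j) p.
  by apply: dle_addP; apply/dleP => j'; rewrite degE; case: eqP => [->|].
have [f [b' [s1 d1 d2 eb _]]] := kfactor e; subst b.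
case: he => g [rg dg].
have ij : i != j by apply/eqP => ?; subst j; rewrite bi in hj.
rewrite ks_comp //; apply: IH.
- move: bN; rewrite (bigD1 j) //= [in X in _ -> X](bigD1 j) //=.
  have -> : (\sum_(j' < k | j' != j) kd (kcomp f b') j'
    = \sum_(j' < k | j' != j) kd b' j')%N.
    by apply: eq_bigr => j' /negbTE ji; rewrite kd_comp // d1 !degE ji.
  rewrite kd_comp // d1 !degE eqxx /=.
  by move: (kd b' j) (\sum_(j' < k | j' != j) kd b' j')%N => x S; lia.
- by move: bi; rewrite kd_comp // degE => /eqP; rewrite addn_eq0 => /andP[_ /eqP].
- rewrite -s1.
  by have [_] := lc ij rg dg (esym (kr_comp s1)) d1.
Qed.

(** Cut [m] at the minimum of [kd m] and [n]. Where [m] is too short, the remainder [b] has degree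
    zero, so an edge available at the cut would survive to the source of [m], against [long n m]. *)
Lemma long_trunc n m : long n m ->
  exists a b, [/\ ks a = kr b, kcomp a b = m, kd a = dmin (kd m) n & in_le n a].
Proof.
move=> lm.
have [p e] : exists p, kd m = dadd (dmin (kd m) n) p.
  by apply: dle_addP; apply/dleP => i; rewrite ffunE geq_minl.
have [a [b [s1 d1 d2 em _]]] := kfactor e; exists a, b; split=> //.
apply/in_leP; split.
  by rewrite d1; apply/dleP => i; rewrite ffunE geq_minr.
move=> i he; rewrite d1 ffunE leq_min leqnn andbT.
have h := lm i; rewrite -em ks_comp // em in h.
rewrite leqNgt; apply/negP => lt.
have mn : minn (kd m i) (n i) = kd m i by apply/minn_idPl/ltnW.
have bi : kd b i = 0%N.
  move: (congr1 (fun x : deg k => x i) e); rewrite /= degE ffunE mn => e'.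
  by apply/eqP; rewrite d2 -(eqn_add2l (kd m i)) addn0 -e'.
by rewrite s1 in he; have := h (has_edge_fwd bi he); rewrite leqNgt lt.
Qed.

End LocallyConvex.

(** * Finiteness of the sets [v Lambda^{<= n}] *)

Section RowFinite.
Hypothesis rf : row_finite L.

Lemma in_le_enum v n : exists2 s : seq (kP L), uniq s &
  forall l, l \in s <-> kr l = v /\ in_le n l.
Proof.
have /choice[e he] : forall d : deg k, exists s : seq (kP L),
    forall l, kr l = v -> kd l = d -> l \in s by move=> d; exact: rf.
(* [M] bounds every coordinate of [n], so each degree below [n] is some [D g], and there are
   finitely many [g]. *)
pose M := \sum_i n i.
pose D (g : {ffun 'I_k -> 'I_M.+1}) : deg k := [ffun i => nat_of_ord (g i)].
pose s0 := flatten [seq e (D g) | g <- enum {ffun 'I_k -> 'I_M.+1}].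
exists (undup [seq l <- s0 | `[< kr l = v /\ in_le n l >]]);
  first exact: undup_uniq.
move=> l; rewrite mem_undup mem_filter; split=> [/andP[/asboolP//]|[rl hl]].
apply/andP; split; first exact/asboolP.
apply/flatten_mapP; exists [ffun i => inord (kd l i)]; first by rewrite mem_enum.
apply: he => //; apply/ffunP => i; rewrite !ffunE inordK // ltnS.
case/in_leP: hl => /dleP/(_ i) h _; apply: leq_trans h _.
by rewrite /M (bigD1 i) //= leq_addr.
Qed.

End RowFinite.
End Paths.

(** * Boundary paths *)

Section Boundary.
Variables (k : nat) (L : kgraph k).
Implicit Types (l m t u a b c : kP L) (v w : kV L) (n p q : deg k) (i j : 'I_k).
Implicit Types x : kP L -> Prop.

(* A boundary path, in [Lambda^{<= infinity}], is encoded as the set of its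
   finite initial segments. *)
Record bdry x : Prop := Bdry {
  bd_meet : forall n, exists2 l, x l & in_le n l;
  bd_pre : forall l m, ks l = kr m -> x (kcomp l m) -> x l;
  bd_dir : forall l m, x l -> x m -> exists a b,
    [/\ ks l = kr a, ks m = kr b, kcomp l a = kcomp m b & x (kcomp l a)] }.

Definition btail l x : kP L -> Prop := fun t => ks l = kr t /\ x (kcomp l t).

(** The concatenation of [l] and [x]: all prefixes of the paths [l t] with [t] in [x], including
    those not comparable with [l]. *)
Definition bcat l x : kP L -> Prop := fun m => exists c t,
  [/\ ks m = kr c, ks l = kr t, kcomp m c = kcomp l t & x t].

Lemma bd_src l x : bdry x -> x l -> x (kid (kr l)).
Proof.
by move=> bx xl; apply: (@bd_pre _ bx _ l); rewrite ?ks_id // kid_l.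
Qed.

Lemma bd_src_eq l m x : bdry x -> x l -> x m -> kr l = kr m.
Proof.
move=> bx xl xm; have [a [b [sa sb e _]]] := bd_dir bx xl xm.
by rewrite -(kr_comp sa) e kr_comp.
Qed.

Lemma bd_id v m x : bdry x -> x (kid v) -> x m -> v = kr m.
Proof. by move=> bx xv /(bd_src_eq bx xv); rewrite kr_id. Qed.

Lemma tail_bdry l x : bdry x -> x l -> bdry (btail l x).
Proof.
move=> bx xl; split.
(* A segment of [x] taken at [kd l + n] begins with [l]; what follows [l] lies in
   [Lambda^{<= n}]. *)
- move=> n; have [u xu /in_leP[u1 u2]] := bd_meet bx (dadd (kd l) n).
  have [a [b [sa sb e xa]]] := bd_dir bx xl xu.
  have [c sc ec] := long_prefix sa sb e (dle_addr (kd l) n) u2; subst u.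
  exists c => //; apply/in_leP; split; last exact: long_drop u2.
  move: u1 => /dleP u1; apply/dleP => i; have := u1 i.
  by rewrite kd_comp // !degE leq_add2l.
- move=> t t' st [sl]; rewrite kr_comp // in sl; rewrite kcompA // => h.
  by split=> //; apply: bd_pre h; rewrite // ks_comp.
- move=> t t' [s1 x1] [s2 x2]; have [a [b [sa sb e xa]]] := bd_dir bx x1 x2.
  rewrite ks_comp // in sa; rewrite ks_comp // in sb.
  exists a, b; split=> //.
    by apply: (@kcomp_inj _ _ l); rewrite ?kr_comp // !kcompA.
  by split; rewrite ?kr_comp // kcompA.
Qed.

Lemma cat_tail l x : bdry x -> x l -> bcat l (btail l x) = x.
Proof.
move=> bx xl; apply/funext => m; apply/propext; split.
  by move=> [c [t [sc st e [_ xt]]]]; apply: (@bd_pre _ bx _ c) => //; rewrite e.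
move=> xm; have [a [b [sa sb e xa]]] := bd_dir bx xl xm.
by exists b, a.
Qed.

Lemma tail_comp l m x : ks l = kr m -> btail m (btail l x) = btail (kcomp l m) x.
Proof.
move=> s1; apply/funext => t; apply/propext; split.
  by move=> [st [_ xt]]; split; rewrite ?ks_comp // -kcompA.
move=> []; rewrite ks_comp // => st; rewrite -kcompA // => xt.
by split=> //; split=> //; rewrite kr_comp.
Qed.

Lemma cat_self l x : bdry x -> x (kid (ks l)) -> bcat l x l.
Proof.
move=> bx xl; exists (kid (ks l)), (kid (ks l)).
by split; rewrite ?kr_id.
Qed.

Lemma cat_src l x : bdry x -> x (kid (ks l)) -> bcat l x (kid (kr l)).
Proof.
move=> bx xl; exists l, (kid (ks l)).
by split; rewrite ?kr_id ?ks_id // kid_l kid_r.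
Qed.

Lemma tail_cat l x : bdry x -> x (kid (ks l)) -> btail l (bcat l x) = x.
Proof.
move=> bx xl; apply/funext => t; apply/propext; split.
  move=> [st [c [u [sc su e xu]]]].
  rewrite ks_comp // in sc; rewrite -kcompA // in e.
  apply: (@bd_pre _ bx _ c) => //.
  by rewrite (@kcomp_inj _ _ l (kcomp t c) u) // kr_comp.
move=> xt; have st := bd_id bx xl xt.
split=> //; exists (kid (ks t)), t.
by split; rewrite ?ks_comp ?kr_id // -(ks_comp st) kid_r.
Qed.

Lemma cat_comp l m x : ks l = kr m -> bcat l (bcat m x) = bcat (kcomp l m) x.
Proof.
move=> s1; apply/funext => p; apply/propext; split.
  move=> [c [t [sc st e [c' [u [sc' su e' xu]]]]]].
  have sc2 : ks c = kr c'.
    by rewrite -sc' -(ks_comp st) -e ks_comp.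
  exists (kcomp c c'), u; split; rewrite ?kr_comp ?ks_comp //.
  by rewrite kcompA // e -kcompA // e' kcompA.
move=> [c [u [sc su e xu]]]; rewrite ks_comp // in su.
exists c, (kcomp m u); split; rewrite ?kr_comp // ?kcompA //.
exists (kid (ks u)), u; split; rewrite ?ks_comp ?kr_id //.
by rewrite -(ks_comp su) kid_r.
Qed.

Lemma tail_id v x : bdry x -> x (kid v) -> btail (kid v) x = x.
Proof.
move=> bx xv; apply/funext => t; apply/propext; rewrite /btail ks_id; split.
  by move=> [->]; rewrite kid_l.
by move=> xt; rewrite (bd_id bx xv xt) kid_l.
Qed.

Lemma cat_id v x : bdry x -> x (kid v) -> bcat (kid v) x = x.
Proof. by move=> bx xv; rewrite -[in LHS](tail_id bx xv) cat_tail. Qed.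

Hypothesis lc : locally_convex L.

Lemma cat_bdry l x : bdry x -> x (kid (ks l)) -> bdry (bcat l x).
Proof.
move=> bx xl; split.
(* [l t] may exceed the degree bound [n], but it is long, so its truncation lies in
   [Lambda^{<= n}]. *)
- move=> n; have [t xt /in_leP[_ lt]] := bd_meet bx n.
  have st := bd_id bx xl xt.
  have [a [b [sa e _ na]]] := long_trunc lc (long_comp st lt).
  by exists a => //; exists b, t.
- move=> m m' sm [c [t [sc st e xt]]]; rewrite ks_comp // in sc.
  by exists (kcomp m' c), t; split; rewrite ?kr_comp // kcompA.
- move=> m m' [c [t [sc st e xt]]] [c' [t' [sc' st' e' xt']]].
  have [a [b [sa sb eab xa]]] := bd_dir bx xt xt'.
  have sca : ks c = kr a by rewrite -sa -(ks_comp st) -e ks_comp.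
  have scb : ks c' = kr b by rewrite -sb -(ks_comp st') -e' ks_comp.
  have ema : kcomp m (kcomp c a) = kcomp l (kcomp t a).
    by rewrite kcompA // e -kcompA.
  exists (kcomp c a), (kcomp c' b); split; rewrite ?kr_comp //.
    by rewrite ema eab kcompA // -e' -kcompA.
  exists (kid (ks a)), (kcomp t a); split; rewrite ?ks_comp ?kr_id ?kr_comp //.
  rewrite ema -[in ks a](ks_comp sa) -(@ks_comp _ _ l (kcomp t a)).
    by rewrite kid_r.
  by rewrite kr_comp.
Qed.

(** Build an increasing chain [f], appending at stage [j] a path in [Lambda^{<= (j,...,j)}]; the
    prefixes of the chain form the boundary path. *)
Lemma bdry_exists v : exists2 x, bdry x & x (kid v).
Proof.
have /choice[st hst] : forall ln : kP L * nat, exists t,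
    kr t = ks ln.1 /\ in_le [ffun=> ln.2] t.
  by move=> ln; have [t] := in_le_nonempty (ks ln.1) [ffun=> ln.2]; exists t.
pose fix f (j : nat) : kP L :=
  if j is j'.+1 then kcomp (f j') (st (f j', j')) else kid v.
have fS (j j' : nat) : exists2 c, ks (f j) = kr c & kcomp (f j) c = f (j' + j)%N.
  elim: j' => [|j' [c sc ec]]; first
    by exists (kid (ks (f j))); rewrite ?kr_id ?kid_r.
  have [r1 _] := hst (f (j' + j)%N, (j' + j)%N).
  set t := st _ in r1; have s1 : ks c = kr t by rewrite r1 /= -ec ks_comp.
  by exists (kcomp c t); rewrite ?kr_comp //= kcompA // ec.
exists (fun l => exists (j : nat) c, ks l = kr c /\ kcomp l c = f j); last first.
  exists 0%N, (kid v); rewrite kr_id ks_id; split=> //=.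
  by have := kid_r (kid v); rewrite ks_id.
split.
(* As [J] dominates every coordinate of [n], the piece appended at stage [J] makes [f J.+1] long for
   [n]. *)
- move=> n; pose J := (\sum_i n i)%N.
  have [r1 /in_leP[_ l1]] := hst (f J, J).
  have ln : long n (f J.+1).
    apply: (@long_le _ _ _ [ffun=> J]).
      by apply/dleP => i; rewrite ffunE /J (bigD1 i) //= leq_addr.
    exact: long_comp.
  have [a [b [sa e _ na]]] := long_trunc lc ln.
  by exists a => //; exists J.+1, b.
- move=> l m slm [j [c [sc e]]]; rewrite ks_comp // in sc.
  by exists j, (kcomp m c); rewrite kr_comp // kcompA.
- move=> l m [j [c [sc e]]] [j' [c' [sc' e']]].
  have aux (l1 l2 c1 c2 : kP L) (j1 j2 : nat) : (j1 <= j2)%N -> ks l1 = kr c1 ->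
      ks l2 = kr c2 -> kcomp l1 c1 = f j1 -> kcomp l2 c2 = f j2 ->
      exists a, ks l1 = kr a /\ kcomp l1 a = kcomp l2 c2.
    move=> /subnK <- s1 s2 e1 e2; have [d sd ed] := fS j1 (j2 - j1)%N.
    have sd' : ks c1 = kr d by rewrite -sd -e1 ks_comp.
    by exists (kcomp c1 d); rewrite kr_comp // kcompA // e1 ed e2.
  have fin (y : kP L) (j1 : nat) : y = f j1 ->
      exists (j : nat) c, ks y = kr c /\ kcomp y c = f j.
    by move=> ->; exists j1, (kid (ks (f j1))); rewrite kr_id kid_r.
  have [jj|/ltnW jj] := leqP j j'.
    have [a [sa ea]] := aux _ _ _ _ _ _ jj sc sc' e e'.
    by exists a, c'; split=> //; apply: (fin _ j'); rewrite ea.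
  have [b [sb eb]] := aux _ _ _ _ _ _ jj sc' sc e' e.
  by exists c, b; split=> //; apply: (fin _ j).
Qed.

End Boundary.

(** * The boundary path representation *)

Section Representation.
Local Open Scope ring_scope.
Variables (k : nat) (L : kgraph k) (R : comPzRingType).
Implicit Types (l m : kP L) (v w : kV L) (x : kP L -> Prop).

Notation G := {ffun 'I_k -> int}.
Notation fn := ((kP L -> Prop) -> G -> R).
Notation term := (kpterm L R).
Implicit Types (a b : term) (f : fn).

Definition gd l : G := [ffun i => (kd l i)%:Z].

Lemma gd_comp l m : ks l = kr m -> gd (kcomp l m) = gd l + gd m.
Proof. by move=> s; apply/ffunP => i; rewrite !ffunE kd_comp // degE PoszD. Qed.

Lemma gd0 l : kd l = dzero k -> gd l = 0.
Proof. by move=> e; apply/ffunP => i; rewrite !ffunE e degE. Qed.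

(* The boundary path representation, twisted by the degree so that the
   [Z^k]-grading of the algebra becomes visible. *)
Fixpoint ev (a : term) (f : fn) x (h : G) : R :=
  match a with
  | tzero => 0
  | tadd a b => ev a f x h + ev b f x h
  | tneg a => - ev a f x h
  | tscale r a => r * ev a f x h
  | tmul a b => ev a (ev b f) x h
  | tp v => if `[< bdry x /\ x (kid v) >] then f x h else 0
  | ts l => if `[< bdry x /\ x l >] then f (btail l x) (h - gd l) else 0
  | tsstar l =>
      if `[< bdry x /\ x (kid (ks l)) >] then f (bcat l x) (h + gd l) else 0
  end.

(** Additivity in the function, as right distributivity of the product, read as composition,
    demands; [evZ] does the same for scalars. *)
Lemma evD a f g : ev a (fun x h => f x h + g x h) =
  fun x h => ev a f x h + ev a g x h.
Proof.
elim: a f g => [|a IHa b IHb|a IHa|r a IHa|a IHa b IHb|v|l|l] f g /=;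
  apply/funext => x; apply/funext => h.
- by rewrite addr0.
- by rewrite IHa IHb addrACA.
- by rewrite IHa opprD.
- by rewrite IHa mulrDr.
- by rewrite IHb IHa.
- by case: ifP; rewrite ?addr0.
- by case: ifP; rewrite ?addr0.
- by case: ifP; rewrite ?addr0.
Qed.

Lemma evZ a r f : ev a (fun x h => r * f x h) = fun x h => r * ev a f x h.
Proof.
elim: a f => [|a IHa b IHb|a IHa|r' a IHa|a IHa b IHb|v|l|l] f /=;
  apply/funext => x; apply/funext => h.
- by rewrite mulr0.
- by rewrite IHa IHb mulrDr.
- by rewrite IHa mulrN.
- by rewrite IHa mulrCA.
- by rewrite IHb IHa.
- by case: ifP; rewrite ?mulr0.
- by case: ifP; rewrite ?mulr0.
- by case: ifP; rewrite ?mulr0.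
Qed.

Lemma ev_tsum (s : seq term) f x h : ev (tsum s) f x h = \sum_(a <- s) ev a f x h.
Proof. by elim: s => [|a s IH]; rewrite ?big_nil ?big_cons //= IH. Qed.

Lemma asbool_true (P : Prop) : P -> `[< P >] = true.
Proof. by move=> /asboolP. Qed.

Lemma asbool_false (P : Prop) : ~ P -> `[< P >] = false.
Proof. by move=> h; apply/asboolP. Qed.

Hypothesis lc : locally_convex L.

Lemma ev_kp_eq a b : kp_eq a b -> ev a = ev b.
Proof.
have X (a' b' : term) : (forall f x h, ev a' f x h = ev b' f x h) -> ev a' = ev b'.
  by move=> e; apply/funext => f; apply/funext => x; apply/funext => h.
elim=> {a b}.
- by [].
- by [].
- by move=> a b c _ -> _.
- by move=> a a' b b' _ e1 _ e2; apply: X => f x h /=; rewrite e1 e2.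
- by move=> a a' _ e1; apply: X => f x h /=; rewrite e1.
- by move=> r a a' _ e1; apply: X => f x h /=; rewrite e1.
- by move=> a a' b b' _ e1 _ e2; apply: X => f x h /=; rewrite e1 e2.
- by move=> a b c; apply: X => f x h /=; rewrite addrA.
- by move=> a b; apply: X => f x h /=; rewrite addrC.
- by move=> a; apply: X => f x h /=; rewrite add0r.
- by move=> a; apply: X => f x h /=; rewrite addNr.
- by [].
- by [].
- by move=> a b c; apply: X => f x h /=; rewrite evD.
- by move=> r a b; apply: X => f x h /=; rewrite mulrDr.
- by move=> r r' a; apply: X => f x h /=; rewrite mulrDl.
- by move=> r r' a; apply: X => f x h /=; rewrite mulrA.
- by move=> a; apply: X => f x h /=; rewrite mul1r.
- by [].
- by move=> r a b; apply: X => f x h /=; rewrite evZ.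
- move=> l d0; apply: X => f x h /=; rewrite gd0 // subr0 {1 2}(kd0_id d0).
  by case: ifP => // /asboolP[bx xl]; rewrite tail_id.
- move=> l d0; apply: X => f x h /=; rewrite gd0 // addr0 kd0_ks //.
  by case: ifP => // /asboolP[bx xl]; rewrite (kd0_id d0) cat_id.
- by move=> v; apply: X => f x h /=; case: ifP => [->|].
- move=> v w vw; apply: X => f x h /=; case: asboolP => // -[bx xv].
  by case: asboolP => // -[_ xw]; case: vw; rewrite (bd_id bx xv xw) kr_id.
- move=> l m _ _ s1; apply: X => f x h /=.
  case: asboolP => [[bx xl]|nx].
    rewrite tail_comp // gd_comp // opprD addrA.
    by congr (if _ then _ else _); apply: asbool_equiv_eq;
      split=> [[_ []]|[_ xlm]] //; split=> //; exact: tail_bdry.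
  by rewrite asbool_false // => -[bx /(bd_pre bx s1)] xl; apply: nx.
- move=> l m _ _ s1; apply: X => f x h /=; rewrite ks_comp //.
  case: asboolP => // -[bx xm].
  rewrite asbool_true ?s1; last by split; [exact: cat_bdry|exact: cat_src].
  by rewrite cat_comp // gd_comp // [gd l + _]addrC addrA.
- move=> l _; apply: X => f x h /=; case: (asboolP (_ /\ x l)) => [[bx xl]|nx].
    by rewrite asbool_true //; split=> //; exact: bd_src.
  by case: ifP.
- move=> l _; apply: X => f x h /=; case: asboolP => // -[bx xl].
  rewrite asbool_true //; split; first exact: tail_bdry.
  by split; rewrite ?kr_id // kid_r.
- move=> l _; apply: X => f x h /=.
  by case: asboolP => // -[bx xl]; rewrite asbool_true.
- move=> l _; apply: X => f x h /=; case: asboolP => // -[bx xl].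
  by rewrite asbool_true //; split; [exact: cat_bdry|exact: cat_src].
- move=> n l _ _; apply: X => f x h /=; case: asboolP => // -[bx xl].
  rewrite asbool_true; last by split; [exact: cat_bdry|exact: cat_self].
  by rewrite tail_cat // addrK.
- move=> n l m _ nl nm lm; apply: X => f x h /=; case: asboolP => // -[bx xl].
  case: asboolP => // -[_ [c [t [sc st e _]]]]; case: lm.
  by rewrite (in_le_eq sc st e nm nl).
- move=> n v s _ us hs; apply: X => f x h; rewrite ev_tsum big_map /=.
  (* [s_l s_l^*] acts as the indicator of the boundary paths that start with [l]. *)
  have evl l : (if `[< bdry x /\ x l >]
        then if `[< bdry (btail l x) /\ btail l x (kid (ks l)) >]
          then f (bcat l (btail l x)) (h - gd l + gd l) else 0 else 0)
      = if `[< bdry x /\ x l >] then f x h else 0.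
    case: asboolP => // -[bx xl]; rewrite cat_tail // subrK asbool_true //.
    by split; [exact: tail_bdry|split; rewrite ?kr_id ?kid_r].
  under eq_bigr => l _ do rewrite evl.
  case: asboolP => [[bx xv]|nx]; last first.
    rewrite big_seq big1 // => l /hs[rl _]; case: asboolP => // -[bx xl].
    by case: nx; split=> //; rewrite -rl; exact: bd_src.
  (* [x] has exactly one initial segment in [Lambda^{<= n}], so exactly one summand survives. *)
  have [l xl nl] := bd_meet bx n.
  have ls : l \in s by apply/hs; split=> //; rewrite -(bd_id bx xv xl).
  rewrite (bigD1_seq l) //= asbool_true // big_seq_cond big1 ?addr0 // => m.
  move=> /andP[/hs[_ nm] /eqP ml]; case: asboolP => // -[_ xm]; case: ml.
  by have [a [b [sa sb e _]]] := bd_dir bx xm xl; exact: (in_le_eq sa sb e nm nl).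
Qed.
End Representation.

(** * The Kumjian-Pask algebra as a quotient *)

Section KPAlgebra.
Local Open Scope ring_scope.
Local Open Scope quotient_scope.
Variables (k : nat) (L : kgraph k) (R : comPzRingType).
Notation term := (kpterm L R).

HB.instance Definition _ := gen_eqMixin term.
HB.instance Definition _ := gen_choiceMixin term.

Definition kp_eqb (a b : term) : bool := `[< kp_eq a b >].

Lemma kp_eqb_refl : reflexive kp_eqb.
Proof. by move=> a; apply/asboolP; exact: kp_refl. Qed.

Lemma kp_eqb_sym : symmetric kp_eqb.
Proof. by move=> a b; apply/asboolP/asboolP; exact: kp_sym. Qed.

Lemma kp_eqb_trans : transitive kp_eqb.
Proof.
move=> b a c /asboolP h1 /asboolP h2; apply/asboolP; exact: kp_trans h1 h2.
Qed.

Canonical kp_equiv := EquivRel kp_eqb kp_eqb_refl kp_eqb_sym kp_eqb_trans.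

(** Passing to the quotient makes module identities and finite sums available; the product remains a
    plain operation [kmul], since the algebra need not have a unit. *)
Definition KP := {eq_quot kp_equiv}.
HB.instance Definition _ := Choice.on KP.

Definition cl (a : term) : KP := \pi_{eq_quot kp_equiv} a.

Lemma clP a b : cl a = cl b <-> kp_eq a b.
Proof.
split=> [/eqmodP/asboolP//|h]; exact/eqmodP/asboolP.
Qed.

Definition rep (x : KP) : term := repr (x : {eq_quot kp_equiv}).

Lemma repK x : cl (rep x) = x.
Proof. exact: reprK. Qed.

Lemma clW (P : KP -> Prop) : (forall a, P (cl a)) -> forall x, P x.
Proof. by move=> h x; rewrite -(repK x). Qed.

Lemma rep_cl a : kp_eq (rep (cl a)) a.
Proof. by apply/clP; rewrite repK. Qed.

Definition kadd (x y : KP) : KP := cl (tadd (rep x) (rep y)).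
Definition kopp (x : KP) : KP := cl (tneg (rep x)).
Definition kscale (r : R) (x : KP) : KP := cl (tscale r (rep x)).
Definition kmul (x y : KP) : KP := cl (tmul (rep x) (rep y)).

Lemma kaddE a b : kadd (cl a) (cl b) = cl (tadd a b).
Proof. by apply/clP/kp_cadd; exact: rep_cl. Qed.
Lemma koppE a : kopp (cl a) = cl (tneg a).
Proof. by apply/clP/kp_cneg; exact: rep_cl. Qed.
Lemma kscaleE r a : kscale r (cl a) = cl (tscale r a).
Proof. by apply/clP/kp_cscale; exact: rep_cl. Qed.
Lemma kmulE a b : kmul (cl a) (cl b) = cl (tmul a b).
Proof. by apply/clP/kp_cmul; exact: rep_cl. Qed.

Lemma kaddA : associative kadd.
Proof.
elim/clW=> a; elim/clW=> b; elim/clW=> c; rewrite !kaddE.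
by apply/clP; constructor.
Qed.
Lemma kaddC : commutative kadd.
Proof. by elim/clW=> a; elim/clW=> b; rewrite !kaddE; apply/clP; constructor. Qed.
Lemma kadd0 : left_id (cl (tzero L R)) kadd.
Proof. by elim/clW=> a; rewrite kaddE; apply/clP; constructor. Qed.
Lemma kaddN : left_inverse (cl (tzero L R)) kopp kadd.
Proof. by elim/clW=> a; rewrite koppE kaddE; apply/clP; constructor. Qed.

HB.instance Definition _ := GRing.isZmodule.Build KP kaddA kaddC kadd0 kaddN.

Lemma clD a b : cl (tadd a b) = cl a + cl b. Proof. by rewrite -kaddE. Qed.
Lemma clN a : cl (tneg a) = - cl a. Proof. by rewrite -koppE. Qed.

Lemma kscaleA r s x : kscale r (kscale s x) = kscale (r * s) x.
Proof. by elim/clW: x => a; rewrite !kscaleE; apply/clP/kp_sym; constructor. Qed.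
Lemma kscale1 : left_id 1 kscale.
Proof. by elim/clW=> a; rewrite !kscaleE; apply/clP; constructor. Qed.
Lemma kscaleDr : right_distributive kscale +%R.
Proof.
move=> r; elim/clW=> a; elim/clW=> b; rewrite -clD !kscaleE -clD.
by apply/clP; constructor.
Qed.
Lemma kscaleDl x : {morph kscale^~ x : r s / r + s}.
Proof.
move=> r s /=; elim/clW: x => a.
by rewrite !kscaleE -clD; apply/clP; constructor.
Qed.

HB.instance Definition _ :=
  GRing.Zmodule_isLmodule.Build R KP kscaleA kscale1 kscaleDr kscaleDl.

Lemma clZ r a : cl (tscale r a) = r *: cl a. Proof. by rewrite -kscaleE. Qed.
Lemma cl_eq0 a : cl a = 0 <-> kp_eq a (tzero L R). Proof. exact: clP. Qed.

Local Notation "x ** y" := (kmul x y) (at level 40, left associativity).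

Lemma kmulA x y z : x ** (y ** z) = x ** y ** z.
Proof.
elim/clW: x => a; elim/clW: y => b; elim/clW: z => c.
by rewrite !kmulE; apply/clP; constructor.
Qed.
Lemma kmulDl x y z : (x + y) ** z = x ** z + y ** z.
Proof.
elim/clW: x => a; elim/clW: y => b; elim/clW: z => c.
by rewrite -clD !kmulE -clD; apply/clP; constructor.
Qed.
Lemma kmulDr x y z : x ** (y + z) = x ** y + x ** z.
Proof.
elim/clW: x => a; elim/clW: y => b; elim/clW: z => c.
by rewrite -clD !kmulE -clD; apply/clP; constructor.
Qed.
Lemma kscaleMl r x y : (r *: x) ** y = r *: (x ** y).
Proof.
elim/clW: x => a; elim/clW: y => b.
by rewrite -clZ !kmulE -clZ; apply/clP/kp_sym; constructor.
Qed.
Lemma kscaleMr r x y : x ** (r *: y) = r *: (x ** y).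
Proof.
elim/clW: x => a; elim/clW: y => b.
by rewrite -clZ !kmulE -clZ; apply/clP/kp_sym; constructor.
Qed.
Lemma kmul0l x : 0 ** x = 0.
Proof. by apply: (addIr (0 ** x)); rewrite -kmulDl !add0r. Qed.
Lemma kmul0r x : x ** 0 = 0.
Proof. by apply: (addIr (x ** 0)); rewrite -kmulDr !add0r. Qed.
Lemma kmulNl x y : (- x) ** y = - (x ** y).
Proof. by rewrite -scaleN1r kscaleMl scaleN1r. Qed.
Lemma kmul_sumr x I (s : seq I) (P : pred I) F :
  x ** (\sum_(i <- s | P i) F i) = \sum_(i <- s | P i) x ** F i.
Proof. by elim/big_rec2: _ => [|i y z _ <-]; rewrite ?kmul0r ?kmulDr. Qed.
Lemma cl_tsum (s : seq term) : cl (tsum s) = \sum_(a <- s) cl a.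
Proof. by elim: s => [|a s IH]; rewrite ?big_nil ?big_cons // -IH -clD. Qed.

(** * Generators, their relations and local units *)

Definition gen_p v : KP := cl (tp R v).
Definition gen_s l : KP := cl (ts R l).
Definition gen_s' l : KP := cl (tsstar R l).

Lemma gen_s_deg0 l : kd l = dzero k -> gen_s l = gen_p (kr l).
Proof. by move=> d0; apply/clP; constructor. Qed.
Lemma gen_s'_deg0 l : kd l = dzero k -> gen_s' l = gen_p (kr l).
Proof. by move=> d0; apply/clP; constructor. Qed.
Lemma PP v : gen_p v ** gen_p v = gen_p v.
Proof. by rewrite kmulE; apply/clP/kp_pidem. Qed.
Lemma PPneq v w : v <> w -> gen_p v ** gen_p w = 0.
Proof. by move=> vw; rewrite kmulE; apply/cl_eq0; constructor. Qed.
(** The defining relation treats nonzero degree; vertices are covered by the convention [s_v = p_v].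
    The following relations are extended to all degrees in the same way. *)
Lemma PS l : gen_p (kr l) ** gen_s l = gen_s l.
Proof.
have [/eqP d0|nz] := boolP (kd l == dzero k); first by rewrite gen_s_deg0 // PP.
by rewrite kmulE; apply/clP; constructor.
Qed.
Lemma SP l : gen_s l ** gen_p (ks l) = gen_s l.
Proof.
have [/eqP d0|nz] := boolP (kd l == dzero k); first
  by rewrite gen_s_deg0 // kd0_ks // PP.
by rewrite kmulE; apply/clP; constructor.
Qed.
Lemma S'P l : gen_s' l ** gen_p (kr l) = gen_s' l.
Proof.
have [/eqP d0|nz] := boolP (kd l == dzero k); first by rewrite gen_s'_deg0 // PP.
by rewrite kmulE; apply/clP; constructor.
Qed.
Lemma SS l m : ks l = kr m -> gen_s l ** gen_s m = gen_s (kcomp l m).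
Proof.
move=> s1; have [/eqP d0|nl] := boolP (kd l == dzero k).
  by rewrite gen_s_deg0 // -kd0_ks // s1 PS (kd0_id d0) -(kd0_ks d0) s1 kid_l.
have [/eqP d0|nm] := boolP (kd m == dzero k).
  by rewrite [gen_s m]gen_s_deg0 // -s1 SP (kd0_id d0) -s1 kid_r.
by rewrite kmulE; apply/clP; constructor.
Qed.
Lemma PSneq v m : v <> kr m -> gen_p v ** gen_s m = 0.
Proof. by move=> vm; rewrite -PS kmulA PPneq // kmul0l. Qed.
Lemma SSneq l m : ks l <> kr m -> gen_s l ** gen_s m = 0.
Proof. by move=> lm; rewrite -SP -kmulA PSneq // kmul0r. Qed.
Lemma S'S l : gen_s' l ** gen_s l = gen_p (ks l).
Proof.
have [/eqP d0|nz] := boolP (kd l == dzero k).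
  by rewrite gen_s_deg0 // gen_s'_deg0 // kd0_ks // PP.
by rewrite kmulE; apply/clP; apply: (kp_ck_eq _ nz); exact: in_le_kd.
Qed.
Lemma S'Sneq n l m : in_le n l -> in_le n m -> l <> m -> gen_s' l ** gen_s m = 0.
Proof.
have [/eqP n0|nz] := boolP (n == dzero k).
  have d0 a : in_le n a -> kd a = dzero k.
    move=> [/dleP h _]; apply/ffunP => i; apply/eqP.
    by have := h i; rewrite n0 degE leqn0.
  move=> /d0 dl /d0 dm lm; rewrite gen_s_deg0 // gen_s'_deg0 // PPneq // => r.
  by apply: lm; rewrite (kd0_id dl) (kd0_id dm) r.
by move=> nl nm lm; rewrite kmulE; apply/cl_eq0; apply: (kp_ck_neq _ nz).
Qed.
Lemma P_sum n v s : uniq s ->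
  (forall l : kP L, l \in s <-> kr l = v /\ in_le n l) ->
  gen_p v = \sum_(l <- s) gen_s l ** gen_s' l.
Proof.
move=> us hs; have [/eqP n0|nz] := boolP (n == dzero k).
  have sv : kid v \in s.
    by apply/hs; rewrite kr_id n0 -(kd_id v); split=> //; exact: in_le_kd.
  rewrite (bigD1_seq (kid v)) //= big_seq_cond big1 ?addr0 => [|l].
    by rewrite gen_s_deg0 ?kd_id // gen_s'_deg0 ?kd_id // kr_id PP.
  move=> /andP[/hs[rl nl] /eqP[]]; rewrite n0 in nl.
  by rewrite -rl; exact: in_le0_id.
rewrite /gen_p (proj2 (clP _ _) (kp_ck_sum R nz us hs)) cl_tsum big_map.
by apply: eq_bigr => l _; rewrite kmulE.
Qed.

(** Finitely many vertices support [x] on the right. Allowing every larger list [W] lets two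
    summands share one. *)
Lemma right_unit x : exists2 V : seq (kV L), uniq V &
  forall W, uniq W -> {subset V <= W} -> x = \sum_(v <- W) x ** gen_p v.
Proof.
have base x' v : x' ** gen_p v = x' -> exists2 V : seq (kV L), uniq V &
    forall W, uniq W -> {subset V <= W} -> x' = \sum_(v <- W) x' ** gen_p v.
  move=> e; exists [:: v] => // W uW vW.
  rewrite (bigD1_seq v) //=; last by apply: vW; rewrite mem_head.
  rewrite big1 ?addr0 // => w /eqP wv.
  by rewrite -e -kmulA PPneq ?kmul0r // => /esym.
elim/clW: x; elim=> [|a [Va ua ha] b [Vb ub hb]|a [Va ua ha]|r a [Va ua ha]
    |a _ b [Vb ub hb]|v|l|l].
- by exists [::] => // W _ _; rewrite big1 // => v _; rewrite kmul0l.
- exists (undup (Va ++ Vb)); first exact: undup_uniq.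
  move=> W uW sW; rewrite clD; under eq_bigr do rewrite kmulDl.
  by rewrite big_split /= -ha -?hb // => v hv; apply: sW;
    rewrite mem_undup mem_cat hv ?orbT.
- exists Va => // W uW sW; rewrite clN; under eq_bigr do rewrite kmulNl.
  by rewrite sumrN -ha.
- exists Va => // W uW sW; rewrite clZ; under eq_bigr do rewrite kscaleMl.
  by rewrite -scaler_sumr -ha.
- exists Vb => // W uW sW; rewrite -kmulE; under eq_bigr do rewrite -kmulA.
  by rewrite -kmul_sumr -hb.
- exact: base (PP v).
- exact: base (SP l).
- exact: base (S'P l).
Qed.

(** * Combinations of real paths *)

(** The list is duplicate-free so that the coefficient of a path of top degree cannot be cancelled
    by another term. *)
Definition path_span v n (x : KP) := exists (s : seq (kP L)) (c : kP L -> R),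
  [/\ uniq s, forall l, l \in s -> ks l = v /\ long n l &
      x = \sum_(l <- s) c l *: gen_s l].

Lemma span_S n l : long n l -> path_span (ks l) n (gen_s l).
Proof.
move=> nl; exists [:: l], (fun=> 1); split=> // [m|].
  by rewrite inE => /eqP ->.
by rewrite big_seq1 scale1r.
Qed.

Lemma span0 v n : path_span v n 0.
Proof. by exists [::], (fun=> 0); rewrite big_nil. Qed.

Lemma spanZ v n r x : path_span v n x -> path_span v n (r *: x).
Proof.
move=> [s [c [us hs ->]]]; exists s, (fun l => r * c l); split=> //.
by rewrite scaler_sumr; apply: eq_bigr => l _; rewrite scalerA.
Qed.

Lemma spanD v n x y : path_span v n x -> path_span v n y -> path_span v n (x + y).
Proof.
move=> [s [c [us hs ->]]] [s' [c' [us' hs' ->]]].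
(* Coefficients are padded with zeros to pass to a common list. *)
have ext (t t' : seq (kP L)) (d : kP L -> R) :
    uniq t -> uniq t' -> {subset t <= t'} ->
    \sum_(l <- t) d l *: gen_s l = \sum_(l <- t') (d l *+ (l \in t)) *: gen_s l.
  move=> ut ut' tt'; rewrite [RHS](bigID (mem t)) /= [X in _ + X]big1 ?addr0.
    rewrite -[RHS]big_filter; have -> : \sum_(l <- t) d l *: gen_s l =
        \sum_(l <- t) (d l *+ (l \in t)) *: gen_s l.
      by apply: eq_big_seq => l ->.
    apply: perm_big; apply: uniq_perm => //; first exact: filter_uniq.
    by move=> l; rewrite mem_filter /=; case: (boolP (l \in t)) => // /tt' ->.
  by move=> l /negbTE ->; rewrite scale0r.
pose t := undup (s ++ s'); have ut : uniq t by exact: undup_uniq.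
exists t, (fun l => c l *+ (l \in s) + c' l *+ (l \in s')); split=> //.
  by move=> l; rewrite mem_undup mem_cat => /orP[/hs|/hs'].
rewrite (ext s t) ?(ext s' t) //; first 1 last.
- by move=> l hl; rewrite mem_undup mem_cat hl orbT.
- by move=> l hl; rewrite mem_undup mem_cat hl.
by rewrite -big_split /=; apply: eq_bigr => l _; rewrite scalerDl.
Qed.

Lemma span_sum v n (s : seq (kP L)) (F : kP L -> KP) :
  (forall l, l \in s -> path_span v n (F l)) -> path_span v n (\sum_(l <- s) F l).
Proof.
move=> h; rewrite big_seq; elim/big_rec: _ => [|l x /h]; first exact: span0.
exact: spanD.
Qed.

Hypothesis lc : locally_convex L.

(** The truncation of [m] at [kd l] lies with [l] in [Lambda^{<= kd l}], so it either equals [l] or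
    is orthogonal to it. *)
Lemma S'S_long l m : long (kd l) m ->
  (exists2 m', ks l = kr m' & m = kcomp l m') \/ gen_s' l ** gen_s m = 0.
Proof.
move=> lm; have [a [b [sa <- _ na]]] := long_trunc lc lm.
have [->|al] := pselect (l = a); first by left; exists b.
by right; rewrite -SS // kmulA (S'Sneq (in_le_kd l) na al) kmul0l.
Qed.

(* The ghost paths occurring in [x] have bounded degree, so they are absorbed
   by every sufficiently long path. *)
Lemma mul_span x : exists N, forall n m, long (dadd N n) m ->
  path_span (ks m) n (x ** gen_s m).
Proof.
elim/clW: x; elim=> [|a [Na ha] b [Nb hb]|a [Na ha]|r a [Na ha]
    |a [Na ha] b [Nb hb]|v|l|l].
- by exists (dzero k) => n m _; rewrite kmul0l; exact: span0.
- exists (dadd Na Nb) => n m nm; rewrite clD kmulDl; apply: spanD.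
    apply: ha; apply: long_le nm.
    by apply/dleP => i; rewrite !degE leq_add2r leq_addr.
  apply: hb; apply: long_le nm.
  by apply/dleP => i; rewrite !degE leq_add2r leq_addl.
- exists Na => n m nm; rewrite clN kmulNl -scaleN1r; apply: spanZ; exact: ha.
- by exists Na => n m nm; rewrite clZ kscaleMl; apply: spanZ; exact: ha.
(* [b] acts first and must leave paths long enough, namely for [Na + n], for [a] to act on. *)
- exists (dadd Nb Na) => n m nm; rewrite -kmulE -kmulA.
  have [|s [c [_ hs ->]]] := hb (dadd Na n) m.
    apply: long_le nm; by apply/dleP => i; rewrite !degE addnA.
  rewrite kmul_sumr; apply: span_sum => l /hs[<- nl].
  by rewrite kscaleMr; apply: spanZ; exact: ha.
- exists (dzero k) => n m nm; rewrite -[cl _]/(gen_p v).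
  have [->|vm] := pselect (v = kr m); last by rewrite PSneq //; exact: span0.
  by rewrite PS; apply: span_S; rewrite dadd0l in nm.
- exists (dzero k) => n m nm; rewrite -[cl _]/(gen_s l).
  have [lm|lm] := pselect (ks l = kr m); last by rewrite SSneq //; exact: span0.
  rewrite SS // -(ks_comp lm); apply: span_S; apply: long_comp => //.
  by rewrite dadd0l in nm.
(* A ghost path removes at most its own degree. *)
- exists (kd l) => n m nm; rewrite -[cl _]/(gen_s' l).
  have [|[m' sm em]|->] := @S'S_long l m; last exact: span0.
    by apply: long_le nm; exact: dle_addr.
  subst m; rewrite -SS // kmulA S'S sm PS ks_comp //.
  by apply: span_S; exact: long_drop nm.
Qed.

Hypothesis rf : row_finite L.

(** Expand [x] by local units and each [p_v] over [v Lambda^{<= n}], whose members are long for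
    [n]. *)
Lemma mulS_eq0 x n : (forall m, long n m -> x ** gen_s m = 0) -> x = 0.
Proof.
move=> h; have [V uV hV] := right_unit x; rewrite (hV V) // big1 // => v _.
have [s us hs] := in_le_enum rf v n.
rewrite (P_sum us hs) kmul_sumr big_seq big1 //.
by move=> l /hs[_ /in_leP[_ nl]]; rewrite kmulA h ?kmul0l.
Qed.

End KPAlgebra.

Local Open Scope ring_scope.

(** * Leading terms *)

Section LexOrder.
Variable k : nat.
Notation G := {ffun 'I_k -> int}.
Implicit Types g h : G.

Definition ltx g h :=
  exists2 i : 'I_k, g i < h i & forall j : 'I_k, (j < i)%N -> g j = h j.

Lemma ltx_irr g : ~ ltx g g.
Proof. by case=> i; rewrite ltxx. Qed.

Lemma ltx_trans g h g' : ltx g h -> ltx h g' -> ltx g g'.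
Proof.
move=> [i gi ei] [j hj ej]; have [ij|ji|/val_inj ij] := ltngtP i j.
- exists i => [|j' j'i]; first by rewrite -ej.
  by rewrite ei // ej // (ltn_trans j'i).
- exists j => [|j' j'j]; first by rewrite ei.
  by rewrite ei ?ej // (ltn_trans j'j).
- subst j; exists i => [|j ji]; first exact: lt_trans hj.
  by rewrite ei ?ej.
Qed.

Lemma ltx_add g h g' : ltx g h -> ltx (g + g') (h + g').
Proof. by move=> [i gi ei]; exists i => [|j /ei e]; rewrite !ffunE ?ltrD2r ?e. Qed.

Lemma ltx_total g h : [\/ g = h, ltx g h | ltx h g].
Proof.
have [/eqP|ne] := boolP (g == h); first by constructor 1.
have [i0 i0P] : exists i : 'I_k, g i != h i.
  apply/existsP; apply: contraNT ne => /existsPn e; apply/eqP/ffunP => i.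
  by apply/eqP; rewrite -[_ == _]negbK.
have [i iP imin] := @arg_minnP _ i0 (fun i => g i != h i) (@nat_of_ord k) i0P.
have e (j : 'I_k) : (j < i)%N -> g j = h j.
  by move=> ji; apply: contraTeq ji => /imin; rewrite -leqNgt.
move: iP; rewrite neq_lt => /orP[lt|lt]; first by constructor 2; exists i.
by constructor 3; exists i => // j /e.
Qed.

Lemma ltx_max (T : eqType) (F : T -> G) (s : seq T) : s <> [::] ->
  exists2 y, y \in s & forall z, z \in s -> F z = F y \/ ltx (F z) (F y).
Proof.
elim: s => // x s IH _; have [->|/eqP/IH[y ys hy]] := eqVneq s [::].
  by exists x; rewrite ?mem_head // => z; rewrite inE => /eqP ->; left.
have [e|lt|lt] := ltx_total (F x) (F y).
- exists y; first by rewrite inE ys orbT.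
  by move=> z; rewrite inE => /orP[/eqP ->|/hy]; first left.
- exists y; first by rewrite inE ys orbT.
  by move=> z; rewrite inE => /orP[/eqP ->|/hy]; first right.
- exists x; first exact: mem_head.
  move=> z; rewrite inE => /orP[/eqP ->|/hy[->|lt']]; [by left|by right|right].
  exact: ltx_trans lt.
Qed.

End LexOrder.

Section Leading.
Variables (k : nat) (L : kgraph k) (R : comPzRingType).
Hypothesis lc : locally_convex L.
Notation term := (kpterm L R).
Notation G := {ffun 'I_k -> int}.
Implicit Types (a b : term) (r : R) (v w : kV L).

(* [a] acts as [r p_v] plus terms of strictly smaller degree. *)
Definition lead a r v := forall (c : G) f,
  (forall x h, ltx c h -> f x h = 0) ->
  (forall x h, ltx c h -> ev a f x h = 0) /\
  (forall x, ev a f x c = if `[< bdry x /\ x (kid v) >] then r * f x c else 0).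

(** [ev b f] again vanishes above [c], so the hypothesis on [a] applies to it. *)
Lemma lead_mul a b r t v : lead a r v -> lead b t v -> lead (tmul a b) (r * t) v.
Proof.
move=> la lb c f hf; have [b1 b2] := lb c f hf; have [a1 a2] := la c _ b1.
split=> //= x; rewrite a2 b2; case: asboolP => // _; exact: mulrA.
Qed.

(** [s_l] raises the top degree of [f] by [gd l] and [s_l^*] lowers it back, moving the leading term
    from the range of [l] to its source. *)
Lemma lead_conj a r l :
  lead a r (kr l) -> lead (tmul (tsstar R l) (tmul a (ts R l))) r (ks l).
Proof.
move=> la c f hf.
have hg x h : ltx (c + gd l) h -> ev (ts R l) f x h = 0.
  move=> /(ltx_add (- gd l)); rewrite addrK => lt /=.
  by case: ifP => // _; exact: hf.
have [a1 a2] := la _ _ hg; split=> [x h lt|x] /=.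
  by case: ifP => // _; apply: a1; exact: ltx_add.
case: asboolP => // -[bx xl]; rewrite a2 asbool_true; last first.
  by split; [exact: cat_bdry|exact: cat_src].
rewrite /= asbool_true; last by split; [exact: cat_bdry|exact: cat_self].
by rewrite tail_cat // addrK.
Qed.

(** [s_{l0}^* s_l] evaluates [f] at a degree shifted by [gd l0 - gd l]: for [l] of lower degree this
    lies above [g], where [f] vanishes. Ties in degree are handled by unique factorisation. *)
Lemma lead_top (s : seq (kP L)) (c : kP L -> R) v l0 : uniq s ->
  (forall l, l \in s -> ks l = v) -> l0 \in s ->
  (forall l, l \in s -> gd l = gd l0 \/ ltx (gd l) (gd l0)) ->
  lead (tmul (tsstar R l0) (tsum [seq tscale (c l) (ts R l) | l <- s])) (c l0) v.
Proof.
move=> us hs l0s hl0 g f hf; rewrite /= (hs _ l0s).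
have low l h : l \in s -> ltx g h -> ltx g (h + gd l0 - gd l).
  move=> /hl0[->|/(ltx_add (- gd l))]; first by rewrite addrK.
  rewrite subrr => /(ltx_add h); rewrite add0r addrC addrA => lt' lt.
  exact: ltx_trans lt lt'.
split=> [x h lt|x].
  case: ifP => // _; rewrite ev_tsum big_map big_seq big1 // => l ls /=.
  by case: ifP => _; rewrite ?mulr0 // hf ?mulr0 //; exact: low.
case: asboolP => // -[bx xv].
have bc : bdry (bcat l0 x) by apply: cat_bdry; rewrite ?(hs _ l0s).
have cl0 : bcat l0 x l0 by apply: cat_self; rewrite ?(hs _ l0s).
rewrite ev_tsum big_map (bigD1_seq l0) //= asbool_true //.
rewrite tail_cat ?(hs _ l0s) // addrK big_seq_cond big1 ?addr0 // => l.
move=> /andP[ls /eqP ll]; case: asboolP => [[_ cl]|_]; last by rewrite mulr0.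
(* Two initial segments of one boundary path with equal degree coincide. *)
have [e|lt] := hl0 _ ls.
  have [a [b [sa sb eab _]]] := bd_dir bc cl cl0; case: ll.
  have [] // := kfact_inj sa sb _ eab.
  apply/ffunP => i; move: (congr1 (fun y : G => y i) e); rewrite /= !ffunE.
  by case.
rewrite hf ?mulr0 //; move: lt => /(ltx_add (- gd l)); rewrite subrr.
by move=> /(ltx_add g); rewrite add0r addrC addrA.
Qed.

Lemma lead_eq0 a r v : lead a r v -> kp_eq a (tzero L R) -> r = 0.
Proof.
move=> la /(ev_kp_eq lc) e; have [x bx xv] := bdry_exists lc v.
(* Test on the indicator of degree zero, which vanishes above [0] and takes the value 1 there. *)
have [|_ /(_ x)] := la 0 (fun _ h => (h == 0)%:R).
  by move=> _ h lt; case: eqP => // h0; case: (@ltx_irr _ (0 : G)); rewrite -{2}h0.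
by rewrite e asbool_true // eqxx mulr1 /= => ->.
Qed.

Lemma scaleP_eq0 r v : r *: gen_p R v = 0 -> r = 0.
Proof.
rewrite -clZ => /cl_eq0 /(ev_kp_eq lc) e; have [x bx xv] := bdry_exists lc v.
move: (congr1 (fun F => F (fun _ _ => 1) x 0) e) => /=.
by rewrite asbool_true // mulr1.
Qed.

Lemma P_neq0 v : (1 : R) != 0 -> gen_p R v <> 0.
Proof. by move=> /eqP n0; rewrite -[gen_p _ _]scale1r => /scaleP_eq0. Qed.

(** * Necessity of the two conditions *)

Lemma kp_ideal_class (K : KP L R -> Prop) : K 0 ->
  (forall x y, K x -> K y -> K (x + y)) -> (forall x, K x -> K (- x)) ->
  (forall x y, K x -> K (kmul y x) /\ K (kmul x y)) ->
  kp_ideal (fun a => K (cl a)).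
Proof.
move=> K0 KD KN KM; split=> //.
- by move=> a b; rewrite clD; exact: KD.
- by move=> a; rewrite clN; exact: KN.
- by move=> a b Ka; rewrite -!kmulE; exact: KM.
- by move=> a b /clP ->.
Qed.

Lemma KP_prime_class (K K' : KP L R -> Prop) : KP_prime L R ->
  kp_ideal (fun a => K (cl a)) -> kp_ideal (fun a => K' (cl a)) ->
  (forall x y, K x -> K' y -> kmul x y = 0) ->
  (forall x, K x -> x = 0) \/ (forall x, K' x -> x = 0).
Proof.
move=> [_ pr] KI KI' KK.
have [a b Ka Kb|h|h] := pr _ _ KI KI'.
- by apply/cl_eq0; rewrite -kmulE; exact: KK.
- by left; elim/clW => a /h/cl_eq0.
- by right; elim/clW => a /h/cl_eq0.
Qed.

(** If [r t = 0], the ideals [rA] and [tA] of the algebra [A] have zero product, so one vanishes;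
    then [r p_v] or [t p_v] is zero, which forces the scalar to be zero. *)
Lemma KP_prime_domain : KP_prime L R -> inhabited (kV L) -> is_integral_domain R.
Proof.
move=> pr [v]; split.
  case: (pr) => [[a na] _]; apply/eqP => R0; apply: na; apply/cl_eq0.
  by rewrite -(scale1r (cl a)) R0 scale0r.
move=> r t rt; pose K (u : R) (x : KP L R) := exists y, x = u *: y.
have KI u : kp_ideal (fun a => K u (cl a)).
  apply: (kp_ideal_class (K := K u)).
  - by exists 0; rewrite scaler0.
  - by move=> _ _ [x ->] [y ->]; exists (x + y); rewrite scalerDr.
  - by move=> _ [x ->]; exists (- x); rewrite scalerN.
  - move=> _ y [x ->]; rewrite kscaleMl kscaleMr.
    by split; [exists (kmul y x)|exists (kmul x y)].
have [|h|h] := KP_prime_class pr (KI r) (KI t).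
- by move=> _ _ [x ->] [y ->]; rewrite kscaleMl kscaleMr scalerA rt scale0r.
- by left; apply: (@scaleP_eq0 _ v); apply: h; exists (gen_p R v).
- by right; apply: (@scaleP_eq0 _ v); apply: h; exists (gen_p R v).
Qed.

Hypothesis rf : row_finite L.

(** For long [m] with range [w], [y s_m] combines paths [l] with the source of [m]; any [l] with
    range [v] would make that source a common descendant, so [p_v] kills them all. *)
Lemma corner_eq0 v w (y : KP L R) :
  (forall l m : kP L, kr l = v -> kr m = w -> ks l <> ks m) ->
  kmul (kmul (gen_p R v) y) (gen_p R w) = 0.
Proof.
move=> nvw; have [N hN] := mul_span lc y.
apply: (mulS_eq0 rf (n := N)) => m Nm; rewrite -kmulA.
have [wm|wm] := pselect (w = kr m); last by rewrite PSneq // kmul0r.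
rewrite wm PS -kmulA; have [|s [c [_ hs ->]]] := hN (dzero k) m.
  by rewrite dadd0r.
rewrite kmul_sumr big_seq big1 // => l /hs[lm _].
by rewrite kscaleMr PSneq ?scaler0 // => vl; case: (nvw l m).
Qed.

(* If [v] and [w] have no common descendant then [p_v A p_w = 0], so the
   two-sided ideal [{x | x A p_w = 0}] contains [p_v], while its right
   annihilator contains [p_w]. *)
Lemma KP_prime_MT3 : KP_prime L R -> (1 : R) != 0 -> MT3 L.
Proof.
move=> pr n0 v w; apply: contrapT => no.
pose K x := forall y, kmul (kmul x y) (gen_p R w) = 0.
pose K' y := forall x, K x -> kmul x y = 0.
have [||||] := @KP_prime_class K K' pr.
- apply: kp_ideal_class.
  + by move=> y; rewrite !kmul0l.
  + by move=> x x' Kx Kx' y; rewrite !kmulDl Kx Kx' addr0.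
  + by move=> x Kx y; rewrite !kmulNl Kx oppr0.
  + move=> x y Kx; split=> z; last by rewrite -(kmulA x) Kx.
    by rewrite -!kmulA [kmul x _]kmulA Kx kmul0r.
- apply: kp_ideal_class.
  + by move=> x _; rewrite kmul0r.
  + by move=> x y Kx Ky z Kz; rewrite kmulDr Kx // Ky // addr0.
  + by move=> x Kx z Kz; rewrite -scaleN1r kscaleMr Kx // scaler0.
  + move=> x y Kx; split=> z Kz; last by rewrite kmulA Kx ?kmul0l.
    by rewrite kmulA Kx // => u; rewrite -(kmulA z) Kz.
- by move=> x y Kx; apply.
- move=> /(_ (gen_p R v)) h; apply: (@P_neq0 v n0); apply: h => y.
  apply: corner_eq0 => l m lv mw lm; apply: no; exists (ks l).
  by split; [exists l|exists m].
(* Since [p_w] is idempotent, [x p_w = (x p_w) p_w], an element of [x A p_w]. *)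
- move=> /(_ (gen_p R w)) h; apply: (@P_neq0 w n0); apply: h => x Kx.
  by rewrite -PP kmulA Kx.
Qed.

(** * Sufficiency of the two conditions *)

Lemma ideal_lead (I : term -> Prop) a : kp_ideal I -> I a ->
  ~ kp_eq a (tzero L R) -> exists a' r v, [/\ I a', r != 0 & lead a' r v].
Proof.
move=> [_ _ _ IM IE] Ia na; have [N hN] := mul_span lc (cl a).
have [m Nm nz] : exists2 m, long N m & kmul (cl a) (gen_s R m) <> 0.
  apply: contrapT => h; apply: na; apply/cl_eq0.
  apply: (mulS_eq0 rf (n := N)) => m Nm.
  by apply: contrapT => nz; apply: h; exists m.
have [|s [c [us hs e]]] := hN (dzero k) m; first by rewrite dadd0r.
(* Dropping zero coefficients ensures that the leading one is nonzero. *)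
pose t := [seq l <- s | c l != 0].
have et : cl (tmul a (ts R m)) = cl (tsum [seq tscale (c l) (ts R l) | l <- t]).
  rewrite -kmulE e cl_tsum big_map big_filter [RHS]big_mkcond /=.
  by apply: eq_bigr => l _; rewrite clZ; case: eqP => // ->; rewrite scale0r.
have [|l0 l0t hl0] := @ltx_max _ _ (@gd _ L) t.
  by move=> t0; apply: nz; move: et; rewrite t0 -kmulE.
have tE l : l \in t -> l \in s /\ c l != 0 by rewrite mem_filter => /andP[].
(* The witness is [s_{l0}^* a s_m], written in the expanded form to which [lead_top] applies. *)
exists (tmul (tsstar R l0) (tsum [seq tscale (c l) (ts R l) | l <- t])).
exists (c l0), (ks m).
split; last 1 first.
- apply: lead_top => //; first exact: filter_uniq.
  by move=> l /tE[/hs[]].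
- apply: (IE (tmul (tsstar R l0) (tmul a (ts R m)))).
    by apply/clP; rewrite -!kmulE kmulE et.
  by apply: (proj1 (IM _ _ _)); exact: (proj2 (IM _ _ _)).
- by case/tE: l0t.
Qed.

Lemma domain_MT3_prime : inhabited (kV L) -> is_integral_domain R -> MT3 L ->
  KP_prime L R.
Proof.
move=> [v0] [n0 dom] mt; split.
  by exists (tp R v0) => /cl_eq0; exact: P_neq0.
move=> I J II JJ IJ; apply: contrapT => /not_orP[/existsNP[a /not_implyP[Ia na]]].
move=> /existsNP[b /not_implyP[Jb nb]].
have [a' [r [v [Ia' rn la]]]] := ideal_lead II Ia na.
have [b' [t [w [Jb' tn lb]]]] := ideal_lead JJ Jb nb.
have [u [[l [lv lu]] [m [mw mu]]]] := mt v w; subst v w.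
have [_ _ _ IM _] := II; have [_ _ _ JM _] := JJ.
(* Compress both elements to the common descendant [u], so that their leading terms multiply. *)
have Ia2 : I (tmul (tsstar R l) (tmul a' (ts R l))).
  by apply: (proj1 (IM _ _ _)); exact: (proj2 (IM _ _ _)).
have Jb2 : J (tmul (tsstar R m) (tmul b' (ts R m))).
  by apply: (proj1 (JM _ _ _)); exact: (proj2 (JM _ _ _)).
have la2 := lead_conj la; have lb2 := lead_conj lb.
rewrite lu in la2; rewrite mu in lb2.
have rt := lead_eq0 (lead_mul la2 lb2) (IJ _ _ Ia2 Jb2).
by case: (dom _ _ rt) => z; [move: rn|move: tn]; rewrite z eqxx.
Qed.

End Leading.

(** [inhabited (kV L)] excludes the empty graph, where (MT3) holds vacuously but the algebra is
    zero, which [KP_prime] rules out. *)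
Theorem theorem4p4 (k : nat) (L : kgraph k) (R : comPzRingType) :
  row_finite L -> locally_convex L -> inhabited (kV L) ->
  KP_prime L R <-> (is_integral_domain R /\ MT3 L).
Proof.
move=> rf lc ne; split=> [pr|[dom mt]]; last exact: domain_MT3_prime.
have dom := KP_prime_domain lc pr ne.
by split=> //; apply: KP_prime_MT3 pr _ => //; case: dom.
Qed.
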